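(* Let $X$ and $Y$ be Banach spaces and let $\tau$ be a locally convex topology on $X$ weaker than the norm topology. If $T:X\to Y$ is an operator which is not $\tau$-Dunford-Pettis, then the family of all bounded $\tau$-continuous functions $f:[0,1]\to X$ such that $Tf=T\circ f$ is not Riemann integrable is spaceable in $\ell_\infty([0,1],X)$.
   Context: All Banach spaces are real; an operator is a continuous linear map between Banach spaces. An operator $T:X\to Y$ is $\tau$-Dunford-Pettis if it carries (norm-)bounded $\tau$-null sequences in $X$ to norm null sequences in $Y$. $\ell_\infty([0,1],X)$ is the Banach space of all bounded functions from $[0,1]$ to $X$ with the supremum norm. A subset $M$ of a Banach space is spaceable if $M\cup\{0\}$ contains a closed infinite-dimensional linear subspace. A tagged partition of $[0,1]$ is a finite collection $\mathcal P=\{(s_i,[t_{i-1},t_i]):1\le i\le N\}$, where the $[t_{i-1},t_i]$ are non-overlapping closed intervals covering $[0,1]$ and $s_i\in(t_{i-1},t_i)$; its norm is $\max_i(t_i-t_{i-1})$, and for $g:[0,1]\to Y$ one puts $g(\mathcal P)=\sum_{i=1}^N (t_i-t_{i-1})g(s_i)$. A function $g:[0,1]\to Y$ is Riemann integrable, with integral $y\in Y$, if for every $\varepsilon>0$ there is $\delta>0$ such that $\|g(\mathcal P)-y\|<\varepsilon$ for all tagged partitions $\mathcal P$ of $[0,1]$ with norm less than $\delta$. *)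

(* Defs.v *)
From HB Require Import structures.
From mathcomp Require Import all_boot all_order all_algebra.
From mathcomp Require Import all_classical all_reals all_analysis.

Set Implicit Arguments.
Unset Strict Implicit.
Unset Printing Implicit Defensive.

Import Order.TTheory GRing.Theory Num.Theory.
Import numFieldNormedType.Exports.

Local Open Scope classical_set_scope.
Local Open Scope ring_scope.

Section BoundedPred.
Context {R : realType} (I : Type) (X : normedModType R).

Definition bounded_pred : {pred I -> X} := mem (bounded_fun : set (I -> X)).

Lemma bounded_predP (f : I -> X) :
  reflect (exists M : R, forall i, `|f i| <= M) (f \in bounded_pred).
Proof.
apply: (iffP idP); rewrite inE/=.
  move=> [M [_ fM]]; exists (M + 1) => i.
  by apply: (fM (M + 1)) => //; rewrite ltrDl.
move=> [M fM]; exists M; split; first exact: num_real.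
by move=> x /ltW Mx i _ /=; apply: le_trans (fM i) Mx.
Qed.

Lemma bounded_submod_closed : submod_closed bounded_pred.
Proof.
split; first by apply/bounded_predP; exists 0 => i; rewrite normr0.
move=> a f g /bounded_predP[M fM] /bounded_predP[N gN]; apply/bounded_predP.
exists (`|a| * M + N) => i; rewrite /GRing.add /GRing.scale /=.
apply: (le_trans (ler_normD _ _)).
by rewrite lerD// normrZ ler_wpM2l.
Qed.

HB.instance Definition _ :=
  GRing.isSubmodClosed.Build R (I -> X) bounded_pred bounded_submod_closed.

End BoundedPred.
Arguments bounded_pred {R} I X.

Definition linfty {R : realType} (I : Type) (X : normedModType R) :=
  {f : I -> X | f \in bounded_pred I X}.

Section LInfty.
Context {R : realType} (I : Type) (X : normedModType R).

Definition linfty_fun (f : linfty I X) : I -> X := \val f.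
Coercion linfty_fun : linfty >-> Funclass.

HB.instance Definition _ := SubType.on (linfty I X).
HB.instance Definition _ := [Choice of linfty I X by <:].
HB.instance Definition _ := [SubChoice_isSubLmodule of linfty I X by <:].

Definition linfty_norm (f : linfty I X) : R := sup (range (fun i => `|f i|)).

Lemma linfty_has_ubound (f : linfty I X) : has_ubound (range (fun i => `|f i|)).
Proof.
have /bounded_predP[M fM] := valP f.
by exists M => _ [i _ <-]; apply: fM.
Qed.

Lemma linfty_norm_ub (f : linfty I X) i : `|f i| <= linfty_norm f.
Proof. by apply: ub_le_sup; [exact: linfty_has_ubound | exists i]. Qed.

Lemma linfty_norm_ge0 (f : linfty I X) : 0 <= linfty_norm f.
Proof.
have [[i _]|noI] := pselect (exists i : I, True).
  exact: le_trans (linfty_norm_ub f i).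
suff -> : linfty_norm f = 0 by [].
by rewrite /linfty_norm sup_out// => -[[_ [i _ _]] _]; apply: noI; exists i.
Qed.

Lemma linfty_norm_le (f : linfty I X) (M : R) : 0 <= M ->
  (forall i, `|f i| <= M) -> linfty_norm f <= M.
Proof.
move=> M0 fM.
have [[i _]|noI] := pselect (exists i : I, True).
  by apply: ge_sup; [exists `|f i|; exists i | move=> _ [j _ <-]].
suff -> : linfty_norm f = 0 by [].
by rewrite /linfty_norm sup_out// => -[[_ [i _ _]] _]; apply: noI; exists i.
Qed.

Lemma linfty_ler_normD (f g : linfty I X) :
  linfty_norm (f + g) <= linfty_norm f + linfty_norm g.
Proof.
apply: linfty_norm_le => [|i]; first by rewrite addr_ge0 ?linfty_norm_ge0.
by apply: (le_trans (ler_normD (f i) (g i))); rewrite lerD ?linfty_norm_ub.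
Qed.

Lemma linfty_normrZ (a : R) (f : linfty I X) :
  linfty_norm (a *: f) = `|a| * linfty_norm f.
Proof.
have le (b : R) (g : linfty I X) :
    linfty_norm (b *: g) <= `|b| * linfty_norm g.
  apply: linfty_norm_le => [|i]; first by rewrite mulr_ge0 ?linfty_norm_ge0.
  have -> : (b *: g : linfty I X) i = b *: g i by [].
  by rewrite normrZ ler_wpM2l ?linfty_norm_ub.
apply/eqP; rewrite eq_le le/=.
have [->|a0] := eqVneq a 0; first by rewrite normr0 mul0r linfty_norm_ge0.
rewrite -ler_pdivlMl ?normr_gt0// -normfV.
by apply: le_trans (le _ _); rewrite scalerA mulVf// scale1r.
Qed.

Lemma linfty_normr0_eq0 (f : linfty I X) : linfty_norm f = 0 -> f = 0.
Proof.
move=> f0; apply: val_inj; apply/funext => i /=.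
by apply/eqP; rewrite -normr_le0 -f0; exact: linfty_norm_ub.
Qed.

HB.instance Definition _ := Lmodule_isNormed.Build R (linfty I X)
  linfty_ler_normD linfty_normrZ linfty_normr0_eq0.

Lemma linfty_normE (f : linfty I X) : `|f| = sup (range (fun i => `|f i|)).
Proof. by []. Qed.

End LInfty.

Section LInftyComplete.
Context {R : realType} (I : Type) (X : completeNormedModType R).

Lemma linfty_complete (F : set_system (linfty I X)) :
  ProperFilter F -> cauchy F -> cvg F.
Proof.
move=> FF /cauchy_ballP Fc.
have Fci (e : R) : 0 < e ->
    exists f : linfty I X, \forall g \near F, `|f - g| < e.
  move=> e0; have /cauchyP/(_ _ e0)[f Ff] : cauchy F by apply/cauchy_ballP.
  by exists f; apply: filterS Ff => g; rewrite -ball_normE.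
have dist_le (f g : linfty I X) i : `|f i - g i| <= `|f - g|.
  exact: (linfty_norm_ub (f - g) i).
have pcvg i : cvg ((fun f : linfty I X => f i) @ F).
  apply/cauchy_cvgP/cauchyP => e e0; have [f Ff] := Fci _ e0.
  exists (f i); rewrite -ball_normE; apply: filterS Ff => g /= fg.
  exact: le_lt_trans fg.
pose h i : X := lim ((fun f : linfty I X => f i) @ F).
have h_le (e : R) (f : linfty I X) :
    (\forall g \near F, `|f - g| < e) -> forall i, `|f i - h i| <= e.
  move=> Ff i; apply/ler_addgt0Pr => d d0.
  have /cvgrPdist_lt/(_ _ d0) hF := pcvg i : _ --> h i.
  near F => g.
  have -> : f i - h i = (f i - g i) + (g i - h i) by rewrite addrA subrK.
  apply: (le_trans (ler_normD _ _)); rewrite lerD//.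
    apply: le_trans (dist_le f g i) _; apply/ltW.
    by near: g.
  by rewrite distrC; apply/ltW; near: g.
have hb : h \in bounded_pred I X.
  have [f Ff] := Fci _ ltr01; apply/bounded_predP.
  exists (`|f| + 1) => i; have -> : h i = f i - (f i - h i) by rewrite subKr.
  by apply: (le_trans (ler_normB _ _)); rewrite lerD ?h_le ?linfty_norm_ub.
pose hs : linfty I X := Sub h hb.
apply/cvg_ex; exists hs; apply/cvgrPdist_le => e e0.
have [f Ff] := Fci _ (divr_gt0 e0 (ltr0n R 2)).
apply: (filterS _ Ff) => g fg.
rewrite (_ : hs - g = (hs - f) + (f - g)); last by rewrite addrA subrK.
apply: (le_trans (ler_normD _ _)); rewrite [leRHS]splitr lerD ?(ltW fg)//.
apply: linfty_norm_le => [|i]; first by rewrite divr_ge0// ltW.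
by have := h_le _ _ Ff i; rewrite distrC.
Unshelve. all: by end_near. Qed.

HB.instance Definition _ :=
  Uniform_isComplete.Build (linfty I X) linfty_complete.

End LInftyComplete.

Definition finite_dimensional {R : realType} {V : normedModType R}
    (W : set V) : Prop :=
  exists (n : nat) (v : 'I_n -> V), (forall i, W (v i)) /\
    forall w, W w -> exists c : 'I_n -> R, w = \sum_(i < n) c i *: v i.

Definition spaceable {R : realType} {V : completeNormedModType R}
    (M : set V) : Prop :=
  exists W : set V, [/\ submod_closed (mem W), closed W,
    ~ finite_dimensional W & W `<=` M `|` [set 0]].

Notation unit_interval R := (set_type (`[0%R, 1%R]%classic : set R)).

(* The i-th interval, i < N, is [t_i, t_(i+1)]; its tag lies in its interior, *)
(* forcing t_0 < t_1 < ... < t_N. Values of tp_point beyond N are unused.     *)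
Record tagged_partition (R : realType) := TaggedPartition {
  tp_size : nat ;
  tp_point : nat -> R ;
  tp_tag : 'I_tp_size -> unit_interval R ;
  tp_point0 : tp_point 0 = 0 ;
  tp_point1 : tp_point tp_size = 1 ;
  tp_tag_itv : forall i : 'I_tp_size,
    tp_point i < \val (tp_tag i) < tp_point i.+1
}.

Definition tp_length {R : realType} (P : tagged_partition R)
    (i : 'I_(tp_size P)) : R :=
  tp_point P i.+1 - tp_point P i.

Definition tp_norm {R : realType} (P : tagged_partition R) : R :=
  \big[Num.max/0]_(i < tp_size P) tp_length i.

Definition riemann_sum {R : realType} {Y : normedModType R}
    (g : unit_interval R -> Y) (P : tagged_partition R) : Y :=
  \sum_(i < tp_size P) tp_length i *: g (tp_tag i).

Definition riemann_integrable {R : realType} {Y : normedModType R}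
    (g : unit_interval R -> Y) : Prop :=
  exists y : Y, forall eps : R, 0 < eps -> exists2 delta : R, 0 < delta &
    forall P : tagged_partition R,
      tp_norm P < delta -> `|riemann_sum g P - y| < eps.

(* A locally convex topology tau on X is given as a locally convex space Xtau *)
(* together with a linear bijection iota : X -> Xtau, standing for the        *)
(* identity map from X to (X, tau): the tau-open sets are the preimages under *)
(* iota of the open sets of Xtau, and tau is weaker than the norm topology    *)
(* exactly when iota is continuous. A tvsType is locally convex, and is not   *)
(* assumed to be Hausdorff.                                                   *)
Definition weaker_lc_topology {R : realType} {X : normedModType R}
    {Xtau : tvsType R} (iota : {linear X -> Xtau}) : Prop :=
  bijective iota /\ continuous iota.

Definition tau_null {R : realType} {X : normedModType R} {Xtau : tvsType R}
    (iota : {linear X -> Xtau}) (x : nat -> X) : Prop :=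
  iota \o x @ \oo --> (0 : Xtau).

Definition tau_continuous {R : realType} {X : normedModType R}
    {Xtau : tvsType R} (iota : {linear X -> Xtau})
    (f : unit_interval R -> X) : Prop :=
  continuous (iota \o f).

Definition tau_dunford_pettis {R : realType} {X Y : normedModType R}
    {Xtau : tvsType R} (iota : {linear X -> Xtau}) (T : X -> Y) : Prop :=
  forall x : nat -> X, bounded_fun x -> tau_null iota x ->
    T \o x @ \oo --> (0 : Y).

(* Main.v *)
Require Import Defs.
From HB Require Import structures.
From mathcomp Require Import all_boot all_order all_algebra.
From mathcomp Require Import all_classical all_reals all_analysis.
From mathcomp Require Import zify ring lra.

Set Implicit Arguments.
Unset Strict Implicit.
Unset Printing Implicit Defensive.

Import Order.TTheory GRing.Theory Num.Theory.
Import numFieldNormedType.Exports.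

Local Open Scope classical_set_scope.
Local Open Scope ring_scope.

(* Take a bounded tau-null sequence x_n with `|T x_n| >= d > 0. As in the     *)
(* construction of a fat Cantor set, choose continuous bumps phi_n with       *)
(* values in [0, 1] and disjoint supports such that phi_n has a peak in at    *)
(* least half of the cells of a uniform grid of mesh 1 / grid n, each of      *)
(* those cells also containing a common zero of all the phi_m. Split nat into *)
(* infinitely many infinite classes, n being in the class fiber_index n. For  *)
(* a bounded sequence a put                                                   *)
(*     f_a = sum_n a_(fiber_index n) phi_n x_n.                               *)
(* Near a common zero of the phi_n, the values of f_a are bounded multiples   *)
(* of late x_n or small multiples of early ones, so f_a is tau-continuous. If *)
(* a_k <> 0, then choosing tags at peaks or at zeros gives, for arbitrarily   *)
(* large n in class k, two Riemann sums of T \o f_a whose difference has norm *)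
(* at least `|a_k| d / 2. Finally a |-> f_a is bounded below on l_infty, so   *)
(* its range is closed and infinite-dimensional.                              *)

(** The construction works because a fixed proportion of the cells survives at every level. The
    cells of level [n] that come too close to the bumps of an earlier level [m] form at most a
    fraction 2^-(m+2) of all, and these fractions sum to less than 1/2 ([card_good_cells]). A
    surviving cell contains both a peak of [phi n] and a common zero of all bumps ([phi_center],
    [phi_quarter]). Moving tags between the two changes a Riemann sum by an amount independent of
    the mesh ([embed_not_riemann]). A nonzero coefficient sequence has a nonzero coordinate, which
    is used at infinitely many levels by [fiber_index_infinite]; hence every nonzero element of the
    range of [embed] is bad. [tau_continuous_embed] gives continuity. The estimate [norm_embed_ge]
    makes the range closed through [closed_range_bounded_below], and injectivity makes it
    infinite-dimensional ([linfty_infinite]). *)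

Section DistInt.
Context {R : realType}.
Implicit Types (x y : R) (k : int).

Definition dist_int (x : R) : R :=
  Num.min (x - (Num.floor x)%:~R) ((Num.floor x)%:~R + 1 - x).

Lemma dist_int_ge0 x : 0 <= dist_int x.
Proof.
have /andP[x1 x2] := floor_itv x; rewrite intrD in x2.
by rewrite /dist_int le_min; apply/andP; split; lra.
Qed.

Lemma dist_int_le x k : dist_int x <= `|x - k%:~R|.
Proof.
have /andP[x1 x2] := floor_itv x; rewrite intrD in x2.
have [kx|xk] := leP k (Num.floor x).
  have : (k%:~R : R) <= (Num.floor x)%:~R by rewrite ler_int.
  by rewrite /dist_int ge_min => kx'; apply/orP; left; rewrite ger0_norm; lra.
have : ((Num.floor x + 1)%:~R : R) <= k%:~R by rewrite ler_int lezD1.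
rewrite intrD /dist_int ge_min => kx'; apply/orP; right.
by rewrite ler0_norm; lra.
Qed.

Lemma dist_int_attained x : exists k, dist_int x = `|x - k%:~R|.
Proof.
have /andP[x1 x2] := floor_itv x; rewrite intrD in x2.
rewrite /dist_int; case: leP => _.
  by exists (Num.floor x); rewrite ger0_norm// subr_ge0.
by exists (Num.floor x + 1); rewrite intrD ler0_norm; lra.
Qed.

Lemma dist_int_lip x y : dist_int x <= dist_int y + `|x - y|.
Proof.
have [k ->] := dist_int_attained y; apply: le_trans (dist_int_le x k) _.
have -> : x - k%:~R = (y - k%:~R) + (x - y) by lra.
exact: ler_normD.
Qed.

Lemma dist_int_ge (e : R) x : (forall k, e <= `|x - k%:~R|) -> e <= dist_int x.
Proof. by have [k ->] := dist_int_attained x. Qed.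

Lemma dist_int_int k : dist_int k%:~R = 0.
Proof.
apply/eqP; rewrite eq_le dist_int_ge0 andbT.
by apply: le_trans (dist_int_le _ k) _; rewrite subrr normr0.
Qed.

Lemma continuous_dist_int : continuous dist_int.
Proof.
move=> x; apply/cvgrPdist_lt => e e0; near=> y.
have xy : `|x - y| < e by near: y; exact: cvgr_dist_lt.
apply: le_lt_trans xy; rewrite ler_norml; apply/andP; split.
  by have := dist_int_lip y x; rewrite distrC; lra.
by have := dist_int_lip x y; lra.
Unshelve. all: by end_near. Qed.

End DistInt.

(** * Nested grids, good cells and disjoint bumps *)

Definition grid (n : nat) : nat := \prod_(k < n) 2 ^ (k + 4).

Lemma gridS n : grid n.+1 = (grid n * 2 ^ (n + 4))%N.
Proof. by rewrite /grid big_ord_recr. Qed.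

Lemma grid_gt0 n : (0 < grid n)%N.
Proof. by rewrite prodn_gt0// => i; rewrite expn_gt0. Qed.

Lemma grid_dvd m n : (m <= n)%N -> (grid m %| grid n)%N.
Proof.
elim: n => [|n IH]; first by rewrite leqn0 => /eqP->.
rewrite leq_eqVlt => /orP[/eqP->//|/IH/dvdn_trans->//].
by rewrite gridS dvdn_mulr.
Qed.

Lemma grid_gt n : (n < grid n)%N.
Proof.
elim: n => [|n IH]; first exact: grid_gt0.
rewrite gridS (leq_trans _ (leq_mul IH (leq_pexp2l _ (leq_addl n 4))))//.
by lia.
Qed.

Section Bumps.
Context {R : realType}.

(* [width n] is the ratio [grid n / grid n.+1], so that bumps of level [n] are
   unions of cells of level [n.+1]. *)
Definition width (n : nat) : R := (2 ^+ (n + 4))^-1.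

Lemma width_gt0 n : 0 < width n.
Proof. by rewrite invr_gt0 exprn_gt0. Qed.

Lemma width_le n : width n <= 16^-1.
Proof.
rewrite /width lef_pV2 ?posrE ?exprn_gt0// exprD.
have : 1 <= (2 : R) ^+ n by rewrite exprn_ege1// ler1n.
have -> : 2 ^+ 4 = 16 :> R by ring.
by move=> n1; rewrite ler_peMl.
Qed.

(** This is [grid n] times the distance from [t] to the nearest centre of a cell of level [n]; the
    shift by 1/2 puts the zeros at the centres. *)
Definition phase (n : nat) (t : R) : R := dist_int ((grid n)%:R * t - 2^-1).

Lemma continuous_phase n : continuous (phase n).
Proof.
move=> t; apply: (continuous_comp (f := fun t : R => (grid n)%:R * t - 2^-1));
  last exact: continuous_dist_int.
apply: cvgB; last exact: cvg_cst.
by apply: cvgM; [exact: cvg_cst | exact: cvg_id].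
Qed.

Definition cell_center n (i : nat) : R := (i%:R + 2^-1) / (grid n)%:R.

(** The threshold [2 * width m] is where [cutoff m] reaches 1. *)
Definition bad_cells m n : {set 'I_(grid n)} :=
  [set i : 'I_(grid n) | phase m (cell_center n i) < 2 * width m]%SET.

(** Each cell of level [m] splits into [2 * P] cells of level [n], of which only the [4 * q] around
    its centre are bad. *)
Lemma card_bad_cells m n : (m < n)%N ->
  (#|bad_cells m n| * 2 ^ (m + 2) <= grid n)%N.
Proof.
move=> mn; have /dvdnP[q qE] := grid_dvd mn.
have q0 : (0 < q)%N by have := grid_gt0 n; rewrite qE muln_gt0 => /andP[].
have M0 := grid_gt0 m.
rewrite gridS in qE.
have e3 : (m + 3 = (m + 2).+1)%N by lia.
have e4 : (m + 4 = (m + 3).+1)%N by lia.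
pose P := (2 ^ (m + 3) * q)%N.
have PE : (8 * q <= P)%N.
  by rewrite leq_mul2r (leq_trans _ (leq_pexp2l _ (leq_addl m 3))) ?orbT.
have nE : grid n = (grid m * (2 * P))%N.
  by rewrite qE /P e4 expnS; lia.
(* Enumerates the windows: [p.1] is the cell of level [m], [p.2] the position in the window of
   [4 * q] cells around its centre. *)
pose f (p : 'I_(grid m) * 'I_(4 * q)) : 'I_(grid n) :=
  odflt (Ordinal (grid_gt0 n)) (insub (p.1 * (2 * P) + (P - 2 * q) + p.2)%N).
suff sub : bad_cells m n \subset [set f p | p in predT]%SET.
  apply: (@leq_trans (grid m * (4 * q) * 2 ^ (m + 2))).
    rewrite leq_mul2r; apply/orP; right.
    apply: leq_trans (subset_leq_card sub) _.
    by apply: leq_trans (leq_imset_card _ _) _; rewrite card_prod !card_ord.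
  rewrite nE /P [in X in (_ <= X)%N]e3 expnS.
  by apply/eq_leq; ring.
apply/fintype.subsetP => i; rewrite inE /phase.
have [k ->] := dist_int_attained ((grid m)%:R * cell_center n i - 2^-1).
(* Clearing denominators turns badness into the integer inequality |2 (i - P - 2 k P) + 1| < 4 q. *)
have -> : (grid m)%:R * cell_center n i - 2^-1 - k%:~R =
    ((i : int) * 2 + 1 - P%:Z * 2 - k * P%:Z * 4)%:~R / (4 * P%:R) :> R.
  have nER : ((grid n)%:R : R) = (grid m)%:R * (2 * P%:R) by rewrite nE !natrM.
  rewrite /cell_center nER !(intrD, intrB, intrM, rmorphN) -!pmulrn/=.
  field; rewrite !pnatr_eq0 -!lt0n M0/=.
  by lia.
rewrite normrM normfV (ger0_norm (_ : 0 <= 4 * P%:R)) ?mulr_ge0//.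
rewrite ltr_pdivrMr; last by rewrite mulr_gt0// ltr0n; lia.
have -> : 2 * width m * (4 * P%:R) = (4 * q)%:Z%:~R.
  rewrite /width /P -pmulrn !natrM natrX e4.
  by rewrite exprS; field; rewrite -natrX pnatr_eq0 -lt0n expn_gt0.
rewrite -intr_norm ltr_int => ik.
(* As [8 * q <= P], the window around centre [k] stays inside cell [k], so the range of [i] forces 0
   <= k < [grid m]. *)
have iN : (i < grid m * (2 * P))%N by rewrite -nE.
have k0 : 0 <= k.
  rewrite leNgt; apply/negP => k0.
  have : k * P%:Z <= -1 * P%:Z by nia.
  by lia.
case: k k0 ik => // k _ ik.
have kN : (k < grid m)%N.
  rewrite ltnNge; apply/negP => Nk.
  have : (grid m * P <= k * P)%N by rewrite leq_mul2r Nk orbT.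
  by lia.
have bN : (i + 2 * q - P - k * (2 * P) < 4 * q)%N by lia.
apply/imsetP; exists (Ordinal kN, Ordinal bN) => //; rewrite /f/=.
rewrite (_ : _ + _ + _ = i)%N; last by lia.
by rewrite insubT ?ltn_ord// => ?; apply: val_inj.
Qed.

Definition good_cells n : {set 'I_(grid n)} :=
  [set i : 'I_(grid n) |
    [forall m : 'I_n, 2 * width m <= phase m (cell_center n i)]]%SET.

Lemma card_good_cells n : ((grid n)%:R : R) / 2 <= #|good_cells n|%:R.
Proof.
have badE : ~: good_cells n = (\bigcup_(m < n) bad_cells m n)%SET.
  apply/setP => i; rewrite !inE negb_forall; apply/existsP/bigcupP.
    by move=> [m]; rewrite -ltNge => im; exists m; rewrite ?inE.
  by move=> [m _]; rewrite inE => im; exists m; rewrite -ltNge.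
have bound : #|~: good_cells n|%:R <= \sum_(m < n) #|bad_cells m n|%:R :> R.
  rewrite badE -natr_sum ler_nat.
  elim/big_ind2 : _ => [|a A b B aA bB|//]; first by rewrite cards0.
  exact: leq_trans (leq_card_setU _ _).1 (leq_add aA bB).
have half : \sum_(m < n) #|bad_cells m n|%:R <= (grid n)%:R / 2 :> R.
  apply: (@le_trans _ _ (\sum_(m < n) (grid n)%:R * (2 ^+ (m + 2))^-1)).
    apply: ler_sum => m _; rewrite ler_pdivlMr ?exprn_gt0//.
    by rewrite -natrX -natrM ler_nat card_bad_cells.
  rewrite -mulr_sumr ler_wpM2l//.
  suff -> : \sum_(m < n) ((2 : R) ^+ (m + 2))^-1 = 2^-1 - (2 ^+ n.+1)^-1.
    by rewrite gerBl invr_ge0 exprn_ge0.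
  elim: n {badE bound} => [|n IH]; first by rewrite big_ord0 expr1 subrr.
  rewrite big_ord_recr IH/= addn2 !exprS; field.
  by rewrite expf_neq0.
have : #|good_cells n|%:R + #|~: good_cells n|%:R = (grid n)%:R :> R.
  by rewrite -natrD cardsC card_ord.
by lra.
Qed.

Definition bumpf n (t : R) : R := Num.max 0 (1 - phase n t / width n).

Definition cutoff n (t : R) : R :=
  Num.min 1 (Num.max 0 (phase n t / width n - 1)).

(* The factor [cutoff m] vanishes wherever [bumpf m] does not, which makes the
   supports disjoint. *)
Definition phi n (t : R) : R := bumpf n t * \prod_(m < n) cutoff m t.

Lemma bumpf_itv n t : 0 <= bumpf n t <= 1.
Proof.
rewrite /bumpf le_max lexx/= ge_max ler01/= gerBl.
by rewrite divr_ge0 ?dist_int_ge0 ?ltW ?width_gt0.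
Qed.

Lemma cutoff_itv n t : 0 <= cutoff n t <= 1.
Proof. by rewrite /cutoff le_min ler01 le_max lexx/= ge_min lexx. Qed.

Lemma phi_itv n t : 0 <= phi n t <= 1.
Proof.
have /andP[b0 b1] := bumpf_itv n t.
have c0 : 0 <= \prod_(m < n) cutoff m t.
  by apply: prodr_ge0 => m _; have /andP[] := cutoff_itv m t.
rewrite /phi mulr_ge0//= mulr_ile1//.
by apply: prodr_ile1 => m _; exact: cutoff_itv.
Qed.

Lemma phi_disjoint m n t : phi m t != 0 -> phi n t != 0 -> m = n.
Proof.
wlog mn : m n / (m < n)%N.
  by move=> h pm pn; have [/h->|/h->|] := ltngtP m n.
rewrite /phi !mulf_eq0 !negb_or => /andP[bm _] /andP[_] /prodf_neq0.
move=> /(_ (Ordinal mn) isT)/= /eqP[]; rewrite /cutoff.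
have : phase m t / width m <= 1.
  rewrite leNgt; apply/negP => p1; move/eqP : bm; apply.
  by apply/eqP; rewrite eq_le ge_max lexx/= subr_le0 ltW// le_max lexx.
by move=> p1; rewrite max_l ?subr_le0// min_r.
Qed.

Lemma continuous_phi n : continuous (phi n).
Proof.
have cp m : continuous (fun t => phase m t / width m).
  by move=> t; apply: cvgM; [exact: continuous_phase | exact: cvg_cst].
have ccut m : continuous (cutoff m).
  move=> t; apply: (@continuous_min _ _ (cst 1)
    (cst 0 \max (fun t => phase m t / width m - 1))); first exact: cvg_cst.
  apply: continuous_max; first exact: cvg_cst.
  by apply: cvgB; [exact: cp | exact: cvg_cst].
have cbump m : continuous (bumpf m).
  move=> t; apply: (@continuous_max _ _ (cst 0)
    (fun t => 1 - phase m t / width m)); first exact: cvg_cst.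
  by apply: cvgB; [exact: cvg_cst | exact: cp].
have cprod (J : seq 'I_n) : continuous (fun t => \prod_(m <- J) cutoff m t).
  elim: J => [|m J IH] t.
    by under eq_fun do rewrite big_nil; exact: cvg_cst.
  under eq_fun do rewrite big_cons.
  by apply: cvgM; [exact: ccut | exact: IH].
by move=> t; apply: cvgM; [exact: cbump | exact: cprod].
Qed.

Lemma phi_center n (i : 'I_(grid n)) : i \in good_cells n ->
  phi n (cell_center n i) = 1.
Proof.
rewrite inE => /forallP good; rewrite /phi big1 ?mulr1.
  have -> : bumpf n (cell_center n i) = Num.max 0 (1 - 0 / width n).
    rewrite /bumpf /phase -(dist_int_int (i : int)).
    congr (Num.max _ (1 - dist_int _ / _)).
    by rewrite /cell_center -pmulrn; field; rewrite pnatr_eq0 -lt0n grid_gt0.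
  by rewrite mul0r subr0 max_r.
move=> m _; rewrite /cutoff.
have p2 : 2 <= phase m (cell_center n i) / width m.
  by rewrite ler_pdivlMr ?width_gt0.
by rewrite max_r ?min_l; lra.
Qed.

Definition cell_quarter n (i : nat) : R := (i%:R + 4^-1) / (grid n)%:R.

(** For m < n, going from the centre to the quarter point changes the phase by at most [width m],
    which the margin [2 * width m] of a good cell absorbs. For m > n, [grid m] is a multiple of 4
    [grid n], so the point lies on the grid of level [m], at phase 1/2. For m = n the phase is
    1/4. *)
Lemma phi_quarter m n (i : 'I_(grid n)) : i \in good_cells n ->
  phi m (cell_quarter n i) = 0.
Proof.
rewrite inE => /forallP good.
have N0 : ((grid n)%:R : R) != 0 by rewrite pnatr_eq0 -lt0n grid_gt0.
suff far : width m <= phase m (cell_quarter n i).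
  rewrite /phi /bumpf max_l ?mul0r// subr_le0 ler_pdivlMr ?width_gt0//.
  by rewrite mul1r.
have [mn|nm|->] := ltngtP m n.
- have /= := good (Ordinal mn).
  have := @dist_int_lip R ((grid m)%:R * cell_center n i - 2^-1)
     ((grid m)%:R * cell_quarter n i - 2^-1).
  rewrite -!/(phase _ _) => lip far.
  suff : `|(grid m)%:R * cell_center n i - 2^-1
     - ((grid m)%:R * cell_quarter n i - 2^-1)| <= width m by lra.
  have -> : (grid m)%:R * cell_center n i - 2^-1
     - ((grid m)%:R * cell_quarter n i - 2^-1) =
     (grid m)%:R / (4 * (grid n)%:R).
    by rewrite /cell_center /cell_quarter; field.
  rewrite ger0_norm ?divr_ge0 ?mulr_ge0//.
  rewrite ler_pdivrMr ?mulr_gt0 ?ltr0n ?grid_gt0//.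
  rewrite /width mulrC ler_pdivlMr ?exprn_gt0// -natrX -!natrM ler_nat.
  by rewrite -gridS; have := dvdn_leq (grid_gt0 n) (grid_dvd mn); lia.
- apply: (le_trans (width_le m)); apply: dist_int_ge => k.
  have /dvdnP[q qE] := grid_dvd nm.
  rewrite gridS in qE.
  have -> : (grid m)%:R * cell_quarter n i - 2^-1 - k%:~R =
      ((q * 2 ^ (n + 2) * (4 * i + 1))%:Z * 2 - 1 - k * 2)%:~R / 2 :> R.
    rewrite /cell_quarter qE (_ : n + 4 = (n + 2) + 2)%N; last by lia.
    rewrite expnD !(intrD, intrB, intrM, rmorphN) -!pmulrn !(natrM, natrD)/=.
    by field.
  rewrite normrM normfV (ger0_norm (_ : 0 <= 2))// -intr_norm.
  have : (1%:~R : R) <=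
      `|(q * 2 ^ (n + 2) * (4 * i + 1))%:Z * 2 - 1 - k * 2|%:~R.
    by rewrite ler_int; lia.
  by rewrite rmorph1; lra.
- apply: (le_trans (width_le n)); apply: dist_int_ge => k.
  have -> : (grid n)%:R * cell_quarter n i - 2^-1 - k%:~R =
      ((i : int) * 4 - 1 - k * 4)%:~R / 4 :> R.
    rewrite /cell_quarter !(intrD, intrB, intrM, rmorphN) -!pmulrn.
    by field.
  rewrite normrM normfV (ger0_norm (_ : 0 <= 4))// -intr_norm.
  have : (1%:~R : R) <= `|(i : int) * 4 - 1 - k * 4|%:~R.
    by rewrite ler_int; lia.
  by rewrite rmorph1; lra.
Qed.

End Bumps.

(** * Riemann sums over uniform partitions *)

Section RiemannSums.
Context {R : realType}.

Lemma cauchy_riemann_sums (Y : normedModType R) (g : unit_interval R -> Y)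
    (c : R) : riemann_integrable g -> 0 < c ->
  exists2 delta : R, 0 < delta & forall P Q : tagged_partition R,
    tp_norm P < delta -> tp_norm Q < delta ->
    `|riemann_sum g P - riemann_sum g Q| < c.
Proof.
move=> [y gy] c0; have [d d0 yd] := gy _ (divr_gt0 c0 (ltr0n R 2)).
exists d => // P Q /yd Pd /yd Qd.
have -> : riemann_sum g P - riemann_sum g Q =
    (riemann_sum g P - y) + (y - riemann_sum g Q) by rewrite addrA subrK.
apply: (le_lt_trans (ler_normD _ _)); rewrite [ltRHS]splitr ltrD//.
by rewrite distrC.
Qed.

Fact unit_interval0 : (0 : R) \in (`[0%R, 1%R]%classic : set R).
Proof. by rewrite inE /= in_itv /= lexx ler01. Qed.

Definition to_unit (t : R) : unit_interval R :=
  insubd (SigSub unit_interval0) t.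

Lemma to_unitK (t : R) : 0 <= t <= 1 -> \val (to_unit t) = t.
Proof. by move=> t01; rewrite insubdK// inE/= in_itv. Qed.

Lemma cell_in_unit N (i : 'I_N) (c : R) : 0 < c < 1 ->
  0 <= (i%:R + c) / N%:R <= 1.
Proof.
move=> /andP[c0 c1]; have i0 : (0 : R) <= i%:R by [].
have N0 : (0 : R) < N%:R by rewrite ltr0n (leq_ltn_trans _ (ltn_ord i)).
have : (i.+1%:R : R) <= N%:R by rewrite ler_nat.
rewrite -natr1 => iN; apply/andP; split; first by apply: divr_ge0; lra.
by rewrite ler_pdivrMr//; lra.
Qed.

Lemma tag_in_cell N (c : 'I_N -> R) (c01 : forall i, 0 < c i < 1) (i : 'I_N) :
  i%:R / N%:R < \val (to_unit ((i%:R + c i) / N%:R)) < i.+1%:R / N%:R.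
Proof.
have /andP[c0 c1] := c01 i.
have N0 : (0 : R) < N%:R by rewrite ltr0n (leq_ltn_trans _ (ltn_ord i)).
rewrite to_unitK ?cell_in_unit// !ltr_pM2r ?invr_gt0// -natr1.
by apply/andP; split; lra.
Qed.

Definition uniform_partition N (N0 : (0 < N)%N) (c : 'I_N -> R)
    (c01 : forall i, 0 < c i < 1) : tagged_partition R :=
  @TaggedPartition R N (fun i => i%:R / N%:R) _ (mul0r _)
    (divff (lt0r_neq0 (eq_ind_r is_true N0 (ltr0n R N)))) (tag_in_cell c01).

Section UniformPartition.
Context (N : nat) (N0 : (0 < N)%N) (c : 'I_N -> R).
Context (c01 : forall i, 0 < c i < 1).

Lemma uniform_partition_length i :
  @tp_length R (uniform_partition N0 c01) i = N%:R^-1.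
Proof. by rewrite /tp_length/= -mulrBl -natr1 addrAC subrr add0r mul1r. Qed.

Lemma uniform_partition_norm (delta : R) : N%:R^-1 < delta ->
  tp_norm (uniform_partition N0 c01) < delta.
Proof.
move=> Nd; apply: bigmax_lt => [|i _]; last by rewrite uniform_partition_length.
by apply: le_lt_trans Nd; rewrite invr_ge0.
Qed.

Lemma uniform_partition_sum (Y : normedModType R) (g : unit_interval R -> Y) :
  riemann_sum g (uniform_partition N0 c01) =
  N%:R^-1 *: \sum_(i < N) g (to_unit ((i%:R + c i) / N%:R)).
Proof.
rewrite /riemann_sum scaler_sumr.
by apply: eq_bigr => i _; rewrite uniform_partition_length.
Qed.

End UniformPartition.
End RiemannSums.

(** * Closed and infinite-dimensional ranges *)

Lemma closed_range_bounded_below (R : realType) (U V : completeNormedModType R)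
    (J : {linear U -> V}) (c : R) : continuous J -> 0 < c ->
  (forall u, c * `|u| <= `|J u|) -> closed (range J).
Proof.
move=> Jcont c0 Jc v vcl.
have near_v n : {u : U | `|v - J u| < n.+1%:R^-1}.
  apply: cid; have [|w [[u _ <-] uv]] := vcl (ball v n.+1%:R^-1).
    by apply: nbhsx_ballx; rewrite invr_gt0.
  by exists u; move: uv; rewrite -ball_normE.
pose u n := sval (near_v n).
have uE n : `|v - J (u n)| < n.+1%:R^-1 by exact: svalP (near_v n).
have Ju : J \o u @ \oo --> v.
  apply/cvgrPdist_lt => e e0; have := near_infty_natSinv_lt (PosNum e0).
  by apply: filterS => n; exact: lt_trans (uE n).
(* The lower bound on [J] pulls the Cauchy property of the images back to [u], and [U] is
   complete. *)
have uc : cvg (u @ \oo).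
  apply/cauchy_cvgP/cauchyP => e e0.
  have ce0 : 0 < c * e / 2 by rewrite divr_gt0 ?mulr_gt0.
  have [N _ NP] := near_infty_natSinv_lt (PosNum ce0).
  exists (u N); rewrite -ball_normE; exists N => // n Nn /=.
  rewrite -(ltr_pM2l c0); apply: le_lt_trans (Jc _) _; rewrite linearB/=.
  have -> : J (u N) - J (u n) = (J (u N) - v) + (v - J (u n)).
    by rewrite addrA subrK.
  apply: (le_lt_trans (ler_normD _ _)); rewrite [ltRHS]splitr ltrD//.
    by rewrite distrC; apply: lt_trans (uE N) (NP _ (leqnn _)).
  exact: lt_trans (uE n) (NP _ Nn).
exists (lim (u @ \oo)) => //.
apply: (cvg_unique (@norm_hausdorff _ V) _ Ju).
by apply: continuous_cvg => //; exact: Jcont.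
Qed.

Section LinftySequences.
Context {R : realType}.

Fact bounded_indicator (j : nat) :
  (fun k : nat => (k == j)%:R : R) \in bounded_pred nat R.
Proof.
by apply/bounded_predP; exists 1 => k; rewrite normr_nat lern1 leq_b1.
Qed.

Definition unit_seq j : linfty nat R :=
  exist _ (fun k : nat => (k == j)%:R : R) (bounded_indicator j).

(** With [n] generators, expanding [n.+1] indicator sequences would factor the identity matrix of
    size [n.+1] through dimension [n]. *)
Lemma linfty_infinite (V : normedModType R) (J : {linear linfty nat R -> V}) :
  injective J -> ~ finite_dimensional (range J).
Proof.
move=> Jinj [n [v [vJ gen]]].
have [b bv] : {b : 'I_n -> linfty nat R & forall i, J (b i) = v i}.
  apply: (choice (P := fun i b => J b = v i)) => i.
  by have [b _ <-] := vJ i; exists b.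
have [c cE] : {c : 'I_n.+1 -> 'I_n -> R &
    forall j : 'I_n.+1, unit_seq j = \sum_(i < n) c j i *: b i}.
  apply: (choice (P := fun (j : 'I_n.+1) cj =>
    unit_seq j = \sum_(i < n) cj i *: b i)) => j.
  have [|c cE] := gen (J (unit_seq j)); first by exists (unit_seq j).
  exists c; apply: Jinj; rewrite cE linear_sum/=.
  by apply: eq_bigr => i _; rewrite linearZ/= bv.
pose C := \matrix_(j < n.+1, i < n) c j i.
pose B := \matrix_(i < n, k < n.+1) (b i k : R).
have CB : C *m B = 1%:M.
  apply/matrixP => j k; rewrite !mxE.
  have -> : (j == k)%:R = unit_seq j k :> R by rewrite eq_sym.
  rewrite cE.
  rewrite (big_morph (fun f : linfty nat R => f k) (id1 := 0) (op1 := +%R))//.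
  by apply: eq_bigr => i _; rewrite !mxE.
by have := mulmx1_min CB; rewrite ltnn.
Qed.

End LinftySequences.

(** * The embedding of bounded sequences by bump series *)

Definition fiber_index (n : nat) : nat := logn 2 n.+1.

(** The witness satisfies n + 1 = 2^k 3^N, whose 2-adic valuation is [k]. *)
Lemma fiber_index_infinite k N : exists2 n, (N <= n)%N & fiber_index n = k.
Proof.
have pos : (0 < 2 ^ k * 3 ^ N)%N by rewrite muln_gt0 !expn_gt0.
exists (2 ^ k * 3 ^ N).-1.
  rewrite -ltnS prednK// (leq_trans (ltn_expl N (isT : 1 < 3)%N))//.
  by rewrite leq_pmull ?expn_gt0.
rewrite /fiber_index prednK// lognM ?expn_gt0// pfactorK// lognX.
by rewrite logn_prime// muln0 addn0.
Qed.

Section BumpSeries.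
Context {R : realType} (X : completeNormedModType R).
Context (x : nat -> X) (M : R) (xM : forall n, `|x n| <= M).

(* Junk value [0] where all the bumps vanish. *)
Definition active (t : R) : nat := xget 0%N [set n | phi n t != 0].

Lemma activeE n (t : R) : phi n t != 0 -> active t = n.
Proof.
move=> pn; apply: (phi_disjoint (t := t)) => //.
exact: (@xgetI _ 0%N [set n | phi n t != 0] n).
Qed.

(* The pointwise sum of the [a (fiber_index n) * phi n t *: x n], which has at
   most one nonzero term. *)
Definition bump_series (a : linfty nat R) (t : unit_interval R) : X :=
  (a (fiber_index (active (\val t))) * phi (active (\val t)) (\val t)) *:
    x (active (\val t)).

Lemma bump_seriesE a n t : phi n (\val t) != 0 ->
  bump_series a t = (a (fiber_index n) * phi n (\val t)) *: x n.
Proof. by move=> /activeE <-. Qed.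

Lemma bump_series0 a t : (forall n, phi n (\val t) = 0) -> bump_series a t = 0.
Proof. by move=> p0; rewrite /bump_series p0 mulr0 scale0r. Qed.

Lemma norm_bump_series a t : `|bump_series a t| <= M * `|a|.
Proof.
rewrite /bump_series normrZ mulrC ler_pM//.
have /andP[p0 p1] := phi_itv (active (\val t)) (\val t).
rewrite normrM -[leRHS]mulr1 ler_pM ?linfty_norm_ub//.
by rewrite ger0_norm.
Qed.

Lemma bump_series_bounded a :
  bump_series a \in bounded_pred (unit_interval R) X.
Proof.
by apply/bounded_predP; exists (M * `|a|) => t; exact: norm_bump_series.
Qed.

Definition embed (a : linfty nat R) : linfty (unit_interval R) X :=
  exist _ (bump_series a) (bump_series_bounded a).

Lemma embedE a t : embed a t = bump_series a t.
Proof. by []. Qed.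

Lemma embed_is_linear : linear embed.
Proof.
move=> r a b; apply: val_inj; apply/funext => t /=.
transitivity (r *: bump_series a t + bump_series b t); last by [].
rewrite /bump_series; set k := fiber_index _.
have -> : linfty_fun (r *: a + b) k = r * linfty_fun a k + linfty_fun b k by [].
by rewrite scalerA -scalerDl mulrDl -mulrA.
Qed.

HB.instance Definition _ :=
  GRing.isLinear.Build R (linfty nat R) (linfty (unit_interval R) X) _ embed
    embed_is_linear.

Lemma norm_embed_le a : `|embed a| <= M * `|a|.
Proof.
apply: linfty_norm_le => [|t]; last exact: norm_bump_series.
by rewrite mulr_ge0// (le_trans (normr_ge0 (x 0%N))).
Qed.

Lemma continuous_embed : continuous embed.
Proof.
apply/linear_bounded_continuous/linear_boundedP.
near=> r => a; apply: le_trans (norm_embed_le a) _.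
by rewrite ler_wpM2r//; near: r; apply: nbhs_pinfty_ge; exact: num_real.
Unshelve. all: by end_near. Qed.

(** Near a common zero of the bumps the active index may be arbitrarily large. Indices from some [N]
    on are handled together by joint continuity of scaling at (0, 0), the finitely many others by
    the continuity of their own terms. *)
Lemma tau_continuous_embed (Xtau : tvsType R) (iota : {linear X -> Xtau}) a :
  continuous iota -> tau_null iota x -> tau_continuous iota (embed a).
Proof.
move=> icont xnull t.
have cval : continuous (fun s : unit_interval R => \val s : R).
  exact: initial_continuous.
have cphi n : continuous (fun s : unit_interval R => phi n (\val s)).
  by move=> s; apply: continuous_comp; [exact: cval | exact: continuous_phi].
have cterm n : continuous (fun s : unit_interval R =>
    iota ((a (fiber_index n) * phi n (\val s)) *: x n)).
  move=> s; apply: (@continuous_comp (unit_interval R) X Xtau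
    (fun s => (a (fiber_index n) * phi n (\val s)) *: x n) iota);
    last exact: icont.
  apply: (@cvgZ _ _ _ (nbhs s)); last exact: cvg_cst.
  by apply: (@cvgM _ _ (nbhs s)); [exact: cvg_cst | exact: cphi].
have [[n pn]|p0] := pselect (exists n, phi n (\val t) != 0).
  have nt : \forall s \near t, phi n (\val s) != 0.
    exact: (@cvgr_neq0 _ _ _ (nbhs t) _ _ _ (cphi n t)).
  have : {near t,
      (fun s => iota ((a (fiber_index n) * phi n (\val s)) *: x n)) =1
      iota \o embed a}.
    apply: (@filterS _ (nbhs t)) nt => s ps.
    by rewrite /= embedE (bump_seriesE _ ps).
  move=> /(@near_eq_cvg _ _ (nbhs t)) /cvg_trans; apply.
  rewrite /continuous_at /= embedE (bump_seriesE _ pn); exact: cterm.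
have {}p0 n : phi n (\val t) = 0.
  by apply/eqP; rewrite -[_ == _]negbK; apply/negP => pn; apply: p0; exists n.
rewrite /= /continuous_at /= embedE bump_series0// linear0 => U U0.
have [[A B] /= [A0 B0] AB] : nbhs ((0, 0) : R^o * Xtau)
    ((fun z : R^o * Xtau => z.1 *: z.2) @^-1` U).
  have := @scale_continuous R Xtau (0, 0).
  by rewrite /continuous_at /= scale0r; apply.
have [r /= r0 rA] := A0.
(* [K *: iota (x n)] is tau-null as well, and the coefficients of [f_a] become
   smaller than [r] after division by [K]. *)
pose K : R := 2 * (`|a| + 1) / r.
have K0 : 0 < K by rewrite divr_gt0// mulr_gt0// ltr_wpDl.
have [N _ NB] : \forall n \near \oo, B (K *: iota (x n)).
  have Kx : (fun n => ((K, iota (x n)) : R^o * Xtau)) @ \oo -->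
      ((K, 0) : R^o * Xtau).
    apply: (@cvg_pair _ _ _ \oo (nbhs (K : R^o)) (nbhs (0 : Xtau))).
      exact: cvg_cst.
    exact: xnull.
  have := cvg_comp _ _ Kx (@scale_continuous _ Xtau (K, 0)).
  by rewrite /= scaler0; apply.
have small : \forall s \near t, forall n : 'I_N,
    U (iota ((a (fiber_index n) * phi n (\val s)) *: x n)).
  apply: (@filter_forall _ _ _ (nbhs t)) => n; apply: (cterm n t).
  by rewrite p0 mulr0 scale0r linear0.
apply: (@filterS _ (nbhs t)) small => s small; rewrite /= embedE.
set n := active (\val s).
have -> : bump_series a s = (a (fiber_index n) * phi n (\val s)) *: x n by [].
have [nN|Nn] := ltnP n N.
  exact: small (Ordinal nN).
have -> : iota ((a (fiber_index n) * phi n (\val s)) *: x n) =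
    (a (fiber_index n) * phi n (\val s) / K) *: (K *: iota (x n)).
  by rewrite linearZ/= scalerA divfK ?gt_eqF.
apply: (AB (_, _)); split; last exact: NB.
apply: rA; rewrite /ball_/= sub0r normrN normrM normfV (gtr0_norm K0).
rewrite ltr_pdivrMr// (_ : r * K = 2 * (`|a| + 1)); last first.
  by rewrite /K mulrC divfK ?gt_eqF.
have /andP[q0 q1] := phi_itv n (\val s).
have aphi : `|a (fiber_index n) * phi n (\val s)| <= `|a|.
  by rewrite normrM -[leRHS]mulr1 ler_pM ?linfty_norm_ub// ger0_norm.
by apply: le_lt_trans aphi _; have := normr_ge0 a; lra.
Qed.

Lemma embed_center a n (i : 'I_(grid n)) : i \in good_cells (R := R) n ->
  embed a (to_unit ((i%:R + 2^-1) / (grid n)%:R)) = a (fiber_index n) *: x n.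
Proof.
move=> gi.
have p1 : phi n (\val (to_unit ((i%:R + 2^-1) / (grid n)%:R))) = 1 :> R.
  by rewrite to_unitK ?phi_center// cell_in_unit//; lra.
by rewrite embedE (@bump_seriesE _ n) p1 ?oner_neq0// mulr1.
Qed.

Lemma embed_quarter a n (i : 'I_(grid n)) : i \in good_cells (R := R) n ->
  embed a (to_unit ((i%:R + 4^-1) / (grid n)%:R)) = 0.
Proof.
move=> gi; apply: bump_series0 => m.
by rewrite to_unitK ?phi_quarter// cell_in_unit//; lra.
Qed.

(** Every coordinate of [a] is seen: at a peak in a good cell of a level in class [k], the value of
    [embed a] is [a k *: x n]. *)
Lemma norm_embed_ge (d : R) a : (forall n, d <= `|x n|) ->
  d * `|a| <= `|embed a|.
Proof.
move=> dx; have [d0|d0] := leP d 0.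
  by apply: (@le_trans _ _ 0); rewrite ?mulr_le0_ge0.
rewrite mulrC -ler_pdivlMr//; apply: linfty_norm_le => [|k].
  by rewrite divr_ge0// ltW.
have [n _ <-] := fiber_index_infinite k 0.
have [i gi] : exists i, i \in good_cells (R := R) n.
  apply/set0Pn; rewrite -card_gt0 -(ltr_nat R).
  by apply: lt_le_trans (card_good_cells n); rewrite divr_gt0// ltr0n grid_gt0.
rewrite ler_pdivlMr//.
have := linfty_norm_ub (embed a) (to_unit ((i%:R + 2^-1) / (grid n)%:R)).
by rewrite (embed_center _ gi) normrZ; apply: le_trans; rewrite ler_wpM2l.
Qed.

Lemma embed_not_riemann (Y : normedModType R) (T : {linear X -> Y}) (d : R)
    (a : linfty nat R) :
  0 < d -> (forall n, d <= `|T (x n)|) -> a != 0 ->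
  ~ riemann_integrable (T \o embed a).
Proof.
move=> d0 dT a0 rint.
have [k ak] : exists k, a k != 0.
  apply/not_existsP => az; move/eqP: a0; apply; apply: val_inj.
  apply/funext => k.
  by apply/eqP; rewrite -[_ == _]negbK; apply/negP/az.
have c0 : 0 < `|a k| * d / 2 by rewrite divr_gt0// mulr_gt0// normr_gt0.
have [del del0 close] := cauchy_riemann_sums rint c0.
have [N _ Ndel] := near_infty_natSinv_lt (PosNum del0).
have [n Nn nk] := fiber_index_infinite k N.
have Gdel : (grid n)%:R^-1 < del.
  apply: le_lt_trans (Ndel _ Nn); rewrite lef_pV2 ?posrE ?ltr0n ?grid_gt0//.
  by rewrite ler_nat grid_gt.
pose c1 (i : 'I_(grid n)) : R := 2^-1.
(* Outside the good cells both partitions carry the same tags, so only good cells contribute to the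
   difference; they have total length at least 1/2. *)
pose c2 (i : 'I_(grid n)) : R :=
  if i \in good_cells (R := R) n then 4^-1 else 2^-1.
have c1P i : 0 < c1 i < 1 by rewrite /c1; apply/andP; split; lra.
have c2P i : 0 < c2 i < 1.
  by rewrite /c2; case: ifP => _; apply/andP; split; lra.
have := close (uniform_partition (grid_gt0 n) c1P)
  (uniform_partition (grid_gt0 n) c2P)
  (uniform_partition_norm _ _ Gdel) (uniform_partition_norm _ _ Gdel).
rewrite !uniform_partition_sum -scalerBr -sumrB.
have -> : \sum_(i < grid n)
    ((T \o embed a) (to_unit ((i%:R + c1 i) / (grid n)%:R)) -
     (T \o embed a) (to_unit ((i%:R + c2 i) / (grid n)%:R))) =
     #|good_cells (R := R) n|%:R *: (a k *: T (x n)).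
  rewrite (bigID (mem (good_cells (R := R) n)))/= [X in _ + X]big1 ?addr0.
    rewrite scaler_nat -sumr_const; apply: eq_bigr => i gi.
    rewrite /c1 /c2 gi (embed_center _ gi) (embed_quarter _ gi) nk.
    by rewrite linear0 subr0 linearZ.
  by move=> i /negbTE ng; rewrite /c1 /c2 ng subrr.
apply/negP; rewrite -leNgt !normrZ mulrA -normrM.
set r := _^-1 * _.
have half : 2^-1 <= r.
  rewrite /r ler_pdivlMl ?ltr0n ?grid_gt0//.
  by have := card_good_cells (R := R) n; lra.
rewrite (ger0_norm (le_trans _ half)) ?invr_ge0// mulrC.
apply: ler_pM => //; first by rewrite mulr_ge0// ltW.
by rewrite ler_wpM2l.
Qed.

End BumpSeries.

(** * Choice of the sequence and conclusion *)

Theorem theorem3p4 (R : realType) (X Y : completeNormedModType R)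
    (Xtau : tvsType R) (iota : {linear X -> Xtau})
    (iotaP : weaker_lc_topology iota)
    (T : {linear X -> Y}) (Tcont : continuous T)
    (TnotDP : ~ tau_dunford_pettis iota T) :
  spaceable [set f : linfty (unit_interval R) X |
    tau_continuous iota f /\ ~ riemann_integrable (T \o f)].
Proof.
have [z [zb znull Tz]] : exists z : nat -> X,
    [/\ bounded_fun z, tau_null iota z & ~ (T \o z @ \oo --> (0 : Y))].
  apply/not_existsP => h; apply: TnotDP => z zb zn.
  by apply: contrapT => Tz; exact: (h z).
have [d d0 dz] : exists2 d : R, 0 < d &
    forall N, exists2 n, (N <= n)%N & d <= `|T (z n)|.
  apply: contrapT => h; apply: Tz; apply/cvgrPdist_lt => e e0.
  apply: contrapT => nN; apply: h; exists e => // N.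
  apply: contrapT => h; apply: nN; exists N => // n Nn /=.
  rewrite sub0r normrN ltNge; apply/negP => ez; apply: h.
  by exists n.
(* [s] may repeat values; [N <= s N] already makes [z \o s] tau-null. *)
have [s sP] : {s : nat -> nat & forall N, (N <= s N)%N /\ d <= `|T (z (s N))|}.
  apply: (choice (P := fun N m => (N <= m)%N /\ d <= `|T (z m)|)) => N.
  by have [n ? ?] := dz N; exists n.
pose x := z \o s.
have xnull : tau_null iota x.
  move=> U /znull[N _ NU]; exists N => // n Nn; apply: NU => /=.
  exact: leq_trans Nn (sP n).1.
have dT n : d <= `|T (x n)| := (sP n).2.
have [M xM] : exists M, forall n, `|x n| <= M.
  have [M [_ zM]] := zb; exists (M + 1) => n.
  by apply: (zM (M + 1)) => //; rewrite ltrDl.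
(* By continuity of [T] at 0, vectors of small norm have images of norm below [d], so the [x n] stay
   away from 0. *)
have [c c0 cx] : exists2 c : R, 0 < c & forall n, c <= `|x n|.
  have /cvgrPdist_lt/(_ _ d0) := Tcont 0.
  rewrite linear0 => /nbhs_ballP[c /= c0 cd].
  exists c => // n; rewrite leNgt; apply/negP => xc.
  have := cd (x n); rewrite -ball_normE /= !sub0r !normrN => /(_ xc).
  by rewrite ltNge dT.
have embed_inj : injective (embed xM).
  move=> a b ab; apply/eqP; rewrite -subr_eq0 -normr_le0 -(pmulr_rle0 _ c0).
  apply: le_trans (norm_embed_ge xM _ cx) _.
  by rewrite linearB/= ab subrr normr0.
exists (range (embed xM)); split.
- split; first by rewrite inE; exists 0 => //; rewrite linear0.
  move=> r _ _ /set_mem[a _ <-] /set_mem[b _ <-]; rewrite inE.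
  by exists (r *: a + b) => //; rewrite linearP.
- exact: (closed_range_bounded_below (@continuous_embed _ _ _ _ xM) c0
    (fun a => norm_embed_ge xM a cx)).
- exact: linfty_infinite.
- move=> _ [a _ <-]; have [->|a0] := eqVneq a 0.
    by right; rewrite linear0.
  left; split; first exact: tau_continuous_embed iotaP.2 xnull.
  exact: embed_not_riemann d0 dT a0.
Qed.
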